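(* Let $M$ be a multiplication module that is also a cancellation module, and let $X$ be a proper submodule of $M$. Then the following are equivalent: (1) $X$ is $\phi$-prime. (2) For all $Y_{1},Y_{2}\in S(M)$, if $Y_{1}Y_{2}\subseteq X$ and $Y_{1}Y_{2}\nsubseteq\phi(X)$, then $Y_{1}\subseteq X$ or $Y_{2}\subseteq X$.
   Context: $R$ is an associative ring with identity, not necessarily commutative, and $M$ is a unitary right $R$-module. $S(M)$ is the set of all submodules of $M$; ''ideal'' means two-sided ideal. For a submodule $Y$ of $M$ and $I\subseteq R$, $YI$ is the set of finite sums of elements $yr$ with $y\in Y$, $r\in I$. $(X:_{R}M)=\{r\in R: Mr\subseteq X\}$. $M$ is a multiplication module if for every $X\in S(M)$ there is an ideal $I$ of $R$ with $X=MI$; then $X=M(X:_{R}M)$ for every $X\in S(M)$. In a multiplication module the product of submodules $Y_1,Y_2$ is $Y_{1}Y_{2}=M(Y_{1}:_{R}M)(Y_{2}:_{R}M)$. $M$ is a cancellation module if $MI=MJ$ implies $I=J$ for all ideals $I,J$ of $R$. A function $\phi:S(M)\to S(M)\cup\{\emptyset\}$ is fixed, with the standing convention that $\phi(X)\subseteq X$ for every $X\in S(M)$. A proper submodule $X$ of $M$ is $\phi$-prime if for every $Y\in S(M)$ and every ideal $I$ of $R$, $YI\subseteq X$ and $YI\nsubseteq\phi(X)$ imply $Y\subseteq X$ or $I\subseteq(X:_{R}M)$. *)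

(* Defs.v *)
From HB Require Import structures.
From mathcomp Require Import all_boot all_algebra.
From mathcomp Require Import boolp classical_sets functions.

Set Implicit Arguments.
Unset Strict Implicit.
Unset Printing Implicit Defensive.

Import GRing.Theory.

Local Open Scope ring_scope.
Local Open Scope classical_set_scope.

(* A unitary right R-module is an object of [lmodType R^c], where R^c is the
   converse ring of R: a *: (b *: m) = (a * b : R^c) *: m becomes
   (m b) a = m (b a) with the product of R. [pzRingType] does not exclude the
   zero ring. *)
Definition rscale (R : pzRingType) (M : lmodType R^c) (m : M) (r : R) : M :=
  (r : R^c) *: m.

Notation "m *>> r" := (rscale m r) (at level 40, left associativity).

Definition submodules (R : pzRingType) (M : lmodType R^c) : set (set M) :=
  [set X : set M | submod_closed (mem X)].
Arguments submodules {R} M.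

(* Two-sided, and possibly equal to R. *)
Definition two_sided_ideal (R : pzRingType) (I : set R) : Prop :=
  zmod_closed (mem I) /\
  (forall a x, I x -> I (a * x)) /\ (forall a x, I x -> I (x * a)).

Definition smul (R : pzRingType) (M : lmodType R^c) (Y : set M) (I : set R) :
    set M :=
  [set m | exists (n : nat) (y : 'I_n -> M) (r : 'I_n -> R),
     (forall i, Y (y i) /\ I (r i)) /\ m = \sum_(i < n) (y i *>> r i)].

(* (X :_R M) *)
Definition residual (R : pzRingType) (M : lmodType R^c) (X : set M) : set R :=
  [set r | forall m : M, X (m *>> r)].

Definition multiplication_module (R : pzRingType) (M : lmodType R^c) : Prop :=
  forall X : set M, submodules M X ->
    exists I : set R, two_sided_ideal I /\ X = smul [set: M] I.

Definition cancellation_module (R : pzRingType) (M : lmodType R^c) : Prop :=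
  forall I J : set R, two_sided_ideal I -> two_sided_ideal J ->
    smul [set: M] I = smul [set: M] J -> I = J.

(* M (Y1 :_R M) (Y2 :_R M), bracketed to the left *)
Definition submod_prod (R : pzRingType) (M : lmodType R^c) (Y1 Y2 : set M) :
    set M :=
  smul (smul [set: M] (residual Y1)) (residual Y2).

Definition proper_submodule (R : pzRingType) (M : lmodType R^c) (X : set M) :
    Prop :=
  submodules M X /\ X <> [set: M].

Definition phi_prime (R : pzRingType) (M : lmodType R^c) (phi : set M -> set M)
    (X : set M) : Prop :=
  proper_submodule X /\
  forall (Y : set M) (I : set R), submodules M Y -> two_sided_ideal I ->
    smul Y I `<=` X -> ~ (smul Y I `<=` phi X) ->
    Y `<=` X \/ I `<=` residual X.

(* Main.v *)
Require Import Defs.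
From HB Require Import structures.
From mathcomp Require Import all_boot all_algebra.
From mathcomp Require Import boolp classical_sets functions.

(** Over a multiplication module every submodule [Y] is recovered from its
    residual, [Y = M (Y :_R M)] ([smul_residual]), so the product of
    submodules collapses to a product of a submodule with an ideal:
    [Y1 Y2 = Y1 (Y2 :_R M)] ([submod_prodE]).  Both conditions of the theorem
    thus speak of products [Y I], condition (2) only for those ideals [I] that
    are residuals of submodules.  Since [(Y2 :_R M)] is an ideal, and since
    [(Y2 :_R M)] lies in [(X :_R M)] exactly when [Y2] lies in [X], (1) gives
    (2).  Conversely, cancellation makes every ideal a residual, namely
    [I = (M I :_R M)] ([residual_smulT]), so (2) applied to [Y] and [M I] is
    the condition of (1) for [Y] and [I]. *)

Set Implicit Arguments.
Unset Strict Implicit.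
Unset Printing Implicit Defensive.

Import GRing.Theory.

Local Open Scope ring_scope.
Local Open Scope classical_set_scope.

Section Residuals.
Context {R : pzRingType} {M : lmodType R^c}.
Implicit Types (X Y : set M) (I J : set R) (m : M) (r s : R).

Lemma rscaleM m r s : m *>> (r * s) = m *>> r *>> s.
Proof. by rewrite /rscale scalerA. Qed.

Lemma submodulesP Y : submodules M Y <->
  Y 0 /\ forall r u v, Y u -> Y v -> Y (u *>> r + v).
Proof.
split=> [[Y0 YD]|[Y0 YD]].
  split=> [|r u v Yu Yv]; first exact/set_mem.
  by apply/set_mem/YD; apply/mem_set.
split=> [|r u v /set_mem Yu /set_mem Yv]; first exact/mem_set.
exact/mem_set/YD.
Qed.

Lemma mem_smul Y I m r : Y m -> I r -> smul Y I (m *>> r).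
Proof.
move=> Ym Ir; exists 1%N, (fun=> m), (fun=> r).
by split=> //; rewrite big_ord1.
Qed.

Lemma smul_sub Y I X : submodules M X ->
  (forall m r, Y m -> I r -> X (m *>> r)) -> smul Y I `<=` X.
Proof.
move=> /submodulesP[X0 XD] YIX _ [n [y [r [yr ->]]]].
apply: (big_ind X) => // [u v Xu Xv|i _].
  by have := XD 1 u v Xu Xv; rewrite /rscale scale1r.
by have [? ?] := yr i; apply: YIX.
Qed.

(** Sums of products [y r] are closed under addition by construction, and
    [(y r) a = y (r a)] moves a scalar into [I]. *)
Lemma smul_submodule Y I :
  (forall a r, I r -> I (r * a)) -> submodules M (smul Y I).
Proof.
move=> Imul; apply/submodulesP; split.
  exists 0%N, (fun=> 0), (fun=> 0).
  by split=> [[]//|]; rewrite big_ord0.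
move=> a _ _ [n [y [r [yr ->]]]] [p [z [s [zs ->]]]].
exists (n + p)%N,
  (fun i => match fintype.split i with inl j => y j | inr k => z k end),
  (fun i => match fintype.split i with inl j => r j * a | inr k => s k end).
split=> [i|].
  by case: (fintype.split i) => [j|k //]; have [? ?] := yr j; split=> //; apply: Imul.
rewrite big_split_ord /= /rscale scaler_sumr; congr (_ + _).
  apply: eq_bigr => j _.
  by rewrite (unsplitK (inl j)) scalerA.
by apply: eq_bigr => k _; rewrite (unsplitK (inr k)).
Qed.

Lemma residual_ideal Y : submodules M Y -> two_sided_ideal (residual Y).
Proof.
move=> /submodulesP[Y0 YD]; split; last first.
  split=> a r Yr m; rewrite rscaleM; first exact: Yr.
  by have := YD a _ _ (Yr m) Y0; rewrite addr0.
split=> [|r s /set_mem Yr /set_mem Ys]; apply/mem_set=> m.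
  by rewrite /rscale scale0r.
have := YD (-1) _ _ (Ys m) (Yr m).
by rewrite /rscale scaleN1r addrC -scalerBl.
Qed.

Lemma sub_residual X I : submodules M X ->
  (I `<=` residual X) <-> (smul [set: M] I `<=` X).
Proof.
move=> Xsub; split=> [IX|MIX r Ir m].
  by apply: smul_sub => // m r _ /IX; apply.
exact/MIX/mem_smul.
Qed.

(** A formal consequence of the adjunction [sub_residual] between [I |-> M I]
    and [X |-> (X :_R M)]; it holds over any module. *)
Lemma smulT_residual_smulT I : two_sided_ideal I ->
  smul [set: M] (residual (smul [set: M] I)) = smul [set: M] I.
Proof.
move=> [_ [_ Imul]]; have MIsub := smul_submodule [set: M] Imul.
have Ires : I `<=` residual (smul [set: M] I) by apply/sub_residual.
apply/seteqP; split; first exact/sub_residual.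
move=> _ [n [y [r [yr ->]]]]; exists n, y, r; split=> // i.
by have [? /Ires] := yr i.
Qed.

Lemma smul_residual Y : multiplication_module M -> submodules M Y ->
  smul [set: M] (residual Y) = Y.
Proof. by move=> Mmult /Mmult[I [Iid ->]]; exact: smulT_residual_smulT. Qed.

Lemma residual_smulT I : cancellation_module M -> two_sided_ideal I ->
  residual (smul [set: M] I) = I.
Proof.
move=> Mcanc Iid; apply: Mcanc => //; last exact: smulT_residual_smulT.
by case: Iid => _ [_ Imul]; exact/residual_ideal/smul_submodule.
Qed.

Lemma submod_prodE Y1 Y2 : multiplication_module M -> submodules M Y1 ->
  submod_prod Y1 Y2 = smul Y1 (residual Y2).
Proof. by move=> Mmult Y1sub; rewrite /submod_prod smul_residual. Qed.

End Residuals.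

Unset Implicit Arguments.

Theorem corollary8 (R : pzRingType) (M : lmodType R^c)
    (phi : {fun submodules M >-> submodules M `|` [set set0]})
    (phi_sub : forall X : set M, submodules M X -> phi X `<=` X)
    (M_mult : multiplication_module M)
    (M_canc : cancellation_module M)
    (X : set M) (X_proper : proper_submodule X) :
  phi_prime phi X <->
  (forall Y1 Y2 : set M, submodules M Y1 -> submodules M Y2 ->
     submod_prod Y1 Y2 `<=` X -> ~ (submod_prod Y1 Y2 `<=` phi X) ->
     Y1 `<=` X \/ Y2 `<=` X).
Proof.
have [Xsub _] := X_proper; split=> [[_ Xprime] Y1 Y2 Y1sub Y2sub|Xprod].
  rewrite submod_prodE // => YX YphiX.
  have [|/(sub_residual _ Xsub)] := Xprime _ _ Y1sub (residual_ideal Y2sub) YX YphiX.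
  - by left.
  - by rewrite smul_residual //; right; auto.
split=> // Y I Ysub Iid YIX YIphiX.
have MIsub : submodules M (smul [set: M] I).
  by case: Iid => _ [_ Imul]; exact: smul_submodule.
have := Xprod _ _ Ysub MIsub.
rewrite submod_prodE // residual_smulT // => /(_ YIX YIphiX).
by case=> [|/(sub_residual _ Xsub)]; [left|right].
Qed.
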